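(* Let $n\ge 2$, let $E \subset \mathbb{R}^n$ be a compact set with $\mathrm{diam}(E) < R$, where $R>0$. Fix $k \in \{1,\ldots, n-1\}$ and let $h \in [0,\infty)$ satisfy $hR < k$. Then there exists a constant $C>0$ depending only on $n,k,hR$ such that \[ \bar\mu(\mathscr{F}_k^-,E) \ge \frac{C}{\mathscr{H}_\Psi(E)}, \qquad \text{where } \, \Psi(t) = \begin{cases} Rt & \text{if } k=1, \\ t^2 |\log(R/t)| & \text{if } k=2, \\ t^2 & \text{if } k \ge 3. \end{cases} \] In particular, $\bar \mu(\mathscr{F}_k^-,E) = +\infty$ whenever $\mathscr{H}_\Psi(E) = 0$.
   Context: For a symmetric matrix $A$ with eigenvalues $\lambda_1(A)\le\dots\le\lambda_n(A)$, set $\mathcal{P}_k^-(A)=\lambda_1(A)+\dots+\lambda_k(A)$. For $h\ge 0$ the operator $\mathscr{F}_k^-$ is $\mathscr{F}_k^-[w] = \mathcal{P}_k^-(\nabla^2 w) - h|\nabla w|$, where $\nabla^2 w$ is the Hessian. Differential inequalities $\mathscr{F}_k^-[w]+cw\ge 0$ for upper semicontinuous $w$ are understood in the viscosity sense. For an open set $\Omega\subset\mathbb{R}^n$, $\bar\mu(\mathscr{F}_k^-,\Omega) = \sup\{c\in\mathbb{R} : \exists\, w \in \mathrm{USC}(\overline\Omega),\ w<0 \text{ on } \overline\Omega,\ \mathscr{F}_k^-[w]+cw\ge 0 \text{ on } \Omega\}$, and for a set $E\subset\mathbb{R}^n$, $\bar\mu(\mathscr{F}_k^-,E)=\sup\{\bar\mu(\mathscr{F}_k^-,\Omega):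 \Omega \text{ open}, E\subset\Omega\}$. For a continuous non-decreasing $\Psi:[0,c)\to[0,\infty)$ with $\Psi(0)=0$ (near $0$), the generalized Hausdorff measure is $\mathscr{H}_\Psi(E) = \lim_{\delta\to 0^+}\inf\{\sum_j \Psi(r_j) : E\subset \bigcup_{j=1}^\infty B_{r_j}(x_j),\ r_j\le\delta\}$. The convention $C/0=+\infty$ is used. *)

(* Defs.v *)
From HB Require Import structures.
From mathcomp Require Import all_boot all_order all_algebra.
From mathcomp Require Import all_classical all_reals all_analysis.
Set Implicit Arguments. Unset Strict Implicit. Unset Printing Implicit Defensive.
Import Order.TTheory GRing.Theory Num.Theory.
Import numFieldNormedType.Exports.
Local Open Scope classical_set_scope.
Local Open Scope ring_scope.

Section Defs.
Variables (R : realType) (n : nat).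
Notation V := 'rV[R]_n.

Definition ebasis (i : 'I_n) : V := delta_mx 0 i.

Definition enorm (v : V) : R := Num.sqrt (\sum_(i < n) v 0 i ^+ 2).

Definition eball (x : V) (r : R) : set V := [set y | enorm (y - x) < r].

(* eigenvalues of A, listed with multiplicity in nondecreasing order:
   the sorted sequence of roots of the characteristic polynomial
   (it exists for symmetric real matrices; [::] otherwise) *)
Definition eigseq (A : 'M[R]_n) : seq R :=
  xget [::] [set s : seq R | sorted <=%R s /\
                             char_poly A = \prod_(x <- s) ('X - x%:P)].

Definition Pkminus (k : nat) (A : 'M[R]_n) : R :=
  \sum_(i < k) nth 0 (eigseq A) i.

Definition grad (phi : V -> R) (x : V) : V :=
  \row_(i < n) derive phi x (ebasis i).
Definition hess (phi : V -> R) (x : V) : 'M[R]_n :=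
  \matrix_(i < n, j < n) derive (fun y => derive phi y (ebasis j)) x (ebasis i).

Definition C2 (phi : V -> R) : Prop :=
  continuous phi /\
  (forall x i, derivable phi x (ebasis i)) /\
  (forall i, continuous (fun y => derive phi y (ebasis i))) /\
  (forall x i j, derivable (fun y => derive phi y (ebasis j)) x (ebasis i)) /\
  (forall i j, continuous (fun x => derive (fun y => derive phi y (ebasis j)) x (ebasis i))).

Definition Fkminus (k : nat) (h : R) (phi : V -> R) (x : V) : R :=
  Pkminus k (hess phi x) - h * enorm (grad phi x).

Definition usc_on (S : set V) (w : V -> R) : Prop :=
  forall x, S x -> forall e : R, 0 < e -> exists2 d : R, 0 < d &
    forall y, S y -> enorm (y - x) < d -> w y < w x + e.

Definition visc_sub (k : nat) (h c : R) (Omega : set V) (w : V -> R) : Prop :=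
  forall x0, Omega x0 -> forall phi : V -> R, C2 phi ->
    phi x0 = w x0 ->
    (exists2 d : R, 0 < d & forall y, eball x0 d y -> w y <= phi y) ->
    0 <= Fkminus k h phi x0 + c * w x0.

Definition mubar_open (k : nat) (h : R) (Omega : set V) : \bar R :=
  ereal_sup [set (c%:E) | c in [set c : R | exists w : V -> R,
     usc_on (closure Omega) w /\
     (forall x, closure Omega x -> w x < 0) /\
     visc_sub k h c Omega w]].

Definition mubar (k : nat) (h : R) (E : set V) : \bar R :=
  ereal_sup [set mubar_open k h Omega | Omega in
              [set Omega : set V | open Omega /\ E `<=` Omega]].

(* generalized Hausdorff measure H_Psi(E); the limit delta -> 0+ of the
   (nonincreasing in delta) inner infima is written as a supremum over delta > 0 *)
Definition hausdorff_delta (Psi : R -> R) (E : set V) (delta : R) : \bar R :=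
  ereal_inf [set (\sum_(0 <= j <oo) (Psi (r j))%:E)%E |
     r in [set r : nat -> R | exists x : nat -> V,
        (forall j, 0 <= r j <= delta) /\
        E `<=` \bigcup_j eball (x j) (r j)]].

Definition hausdorffPsi (Psi : R -> R) (E : set V) : \bar R :=
  ereal_sup [set hausdorff_delta Psi E delta | delta in [set d : R | 0 < d]].

Definition ediam (E : set V) : \bar R :=
  ereal_sup [set (enorm (x - y))%:E | x in E & y in E].

End Defs.

Definition PsiK (R : realType) (k : nat) (Rr : R) (t : R) : R :=
  if k == 1%N then Rr * t
  else if k == 2%N then t ^+ 2 * `|ln (Rr / t)|
  else t ^+ 2.

Definition ediv_const (R : realType) (C : R) (H : \bar R) : \bar R :=
  match H with
  | EFin x => if x == 0 then +oo%E else (C / x)%:E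
  | +oo%E => 0%E
  | -oo%E => -oo%E
  end.

(* Main.v *)
Require Import Defs.
From HB Require Import structures.
From mathcomp Require Import all_boot all_order all_algebra finmap complex.
From mathcomp Require Import all_classical all_reals all_analysis.
From mathcomp Require Import ring lra.
Import Order.TTheory GRing.Theory Num.Theory.
Import numFieldNormedType.Exports.
Local Open Scope classical_set_scope.
Local Open Scope ring_scope.
Set Implicit Arguments.
Unset Strict Implicit.
Unset Printing Implicit Defensive.

                                                                 
                                                                        
                                                                             
                                                                 
                                                         
                                                                       
                                                                 

                                                                           
                                                                         
                                                                   
                                                                               
                                            

                                         

(** An explicit admissible function is built from a cover of [E] by small balls. For one ball, with
    centre p and radius r, put T = sqrt(|x-p|^2 + r^2) and consider G(T), where G'(t) = t K(t) and
    K(t) = (r/t)^k e^{ht}. This G' solves G'' + (k-1)G'/t = h G', the radial Laplace equation of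
    dimension k with drift h. The gradient of G(T) is K (x-p), and its Hessian is K times the
    identity minus a rank-one term, which is nonnegative as long as hT <= k. A sum of k eigenvalues
    therefore pays for the rank-one term at most once, and the operator applied to G(T) is at least
    K k r^2/(2T^2) ([kern_lower]). This is nonnegative for T <= R, and at least k/(4 2^k) inside the
    ball ([kern_lower_near]): using T instead of |x-p| removes the singularity and creates this
    strict gain. Normalised by G(R) = 0, the profile satisfies -e^{hR} Psi(r) <= G <= 0
    ([profile_exists]); the three cases of Psi come from integrating t^{1-k}.

    For a finite cover, take w = sum_j G_j(T_j) - eps. Sums of k smallest eigenvalues are
    superadditive and the norm of the gradient is subadditive, so the contributions add up: the
    operator is at least k/(4 2^k) on the union of the balls, while w >= -e^{hR} S if sum_j Psi(r_j)
    < S and eps is chosen accordingly. Hence c = C/S is admissible for C = k/(4 2^k e^{hR})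
    ([mubar_ge_finite_cover]). Compactness reduces countable covers to finite ones
    ([mubar_ge_cover]), and S decreases to the Hausdorff measure.

    The viscosity inequality is obtained by comparing a test function with w along lines
    ([touching_derivatives]); the spectral theorem turns the resulting bounds on the Hessian form
    into a bound on eigenvalues ([Fkminus_touching]). *)

(** * Eigenvalues of real symmetric matrices *)

Lemma complexRe_mulJ (R : realType) (z w : R[i]) :
  complex.Re (z * Num.conj w) =
  complex.Re z * complex.Re w + complex.Im z * complex.Im w.
Proof. by case: z w => [a b] [c d] /=; ring. Qed.

Lemma complexRe_sum (R : realType) (I : finType) (F : I -> R[i]) :
  complex.Re (\sum_i F i) = \sum_i complex.Re (F i).
Proof. by elim/big_rec2: _ => //= i a [b c] _ <-; case: (F i). Qed.

Lemma char_poly_conj (R : comUnitRingType) (n : nat) (P D : 'M[R]_n) :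
  P \in unitmx -> char_poly (invmx P *m D *m P) = char_poly D.
Proof.
move=> Pu; rewrite /char_poly.
have -> : char_poly_mx (invmx P *m D *m P) =
   map_mx polyC (invmx P) *m char_poly_mx D *m map_mx polyC P.
  rewrite /char_poly_mx mulmxBr mulmxBl -!map_mxM; congr (_ - _).
  by rewrite mul_mx_scalar -scalemxAl -map_mxM mulVmx// map_mx1 scalemx1.
rewrite !det_mulmx mulrC mulrA -det_mulmx -map_mxM mulmxV// map_mx1 det1 mul1r.
by [].
Qed.

(** The matrix is diagonalised over the complex numbers as a Hermitian matrix. The rows of the
    unitary matrix are split into real parts [a] and imaginary parts [b]; the last two conclusions
    are the real parts of the two unitarity identities. *)
Lemma symmetric_spectral (R : realType) (n : nat) (A : 'M[R]_n) : A^T = A ->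
  exists (a b : 'M[R]_n) (l : 'I_n -> R),
  [/\ char_poly A = \prod_i ('X - (l i)%:P),
      forall i, l i = \sum_p \sum_q A p q * (a i p * a i q + b i p * b i q),
      forall i, \sum_p (a i p ^+ 2 + b i p ^+ 2) = 1 &
      forall p q, \sum_i (a i p * a i q + b i p * b i q) = (p == q)%:R].
Proof.
move=> Asym; pose A' : 'M[R[i]]_n := map_mx (real_complex R) A.
have A'h : A' \is hermsymmx.
  apply: realsym_hermsym; first by apply/is_hermitianmxP; rewrite expr0 scale1r map_mx_id// /A' map_trmx Asym.
  by apply/mxOverP => i j; rewrite mxE; apply/complex_realP; exists (A i j).
have sp_real := hermitian_spectral_diag_real A'h.
have Pu := spectral_unitarymx A'.
have /hermitian_normalmx/orthomx_spectralP := A'h.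
move: (spectralmx A') (spectral_diag A') Pu sp_real => P sp Pu sp_real A'E.
have Pun := unitarymx_unit Pu.
have PPt : P *m (P ^t*)%sesqui = 1%:M by apply/unitarymxP.
have PtP : (P ^t*)%sesqui *m P = 1%:M by apply: mulmx1C.
have DE : diag_mx sp = P *m A' *m (P ^t*)%sesqui.
  by rewrite A'E invmx_unitary// !mulmxA PPt mul1mx -mulmxA PPt mulmx1.
exists (map_mx (@complex.Re R) P), (map_mx (@complex.Im R) P),
  (fun i => complex.Re (sp 0 i)); split.
- apply: (map_poly_inj (real_complex R)).
  rewrite map_char_poly -/A' A'E char_poly_conj// char_poly_trig ?diag_mx_is_trig//.
  rewrite rmorph_prod; apply: eq_bigr => i _; rewrite rmorphB/= map_polyX map_polyC.
  rewrite mxE eqxx mulr1n; congr (_ - _%:P).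
  by have /mxOverP/(_ 0 i)/complex_realP[x ->] := sp_real.
- move=> i; have /matrixP/(_ i i) := DE; rewrite !mxE eqxx mulr1n => ->.
  rewrite complexRe_sum exchange_big; apply: eq_bigr => q _ /=.
  rewrite !mxE mulr_suml complexRe_sum; apply: eq_bigr => p _.
  rewrite !mxE -mulrA mulrCA -complexRe_mulJ.
  by move: (P i p * _) => -[u v] /=; ring.
- move=> i; have /matrixP/(_ i i) := PPt; rewrite !mxE eqxx /=.
  move=> /(congr1 (@complex.Re R)); rewrite complexRe_sum => h.
  have -> : 1 = complex.Re (1 : R[i]) by [].
  rewrite -h.
  by apply: eq_bigr => p _; rewrite !mxE complexRe_mulJ !expr2.
- move=> p q; have /matrixP/(_ p q) := PtP; rewrite !mxE => /(congr1 (@complex.Re R)).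
  rewrite complexRe_sum => h; transitivity (complex.Re ((p == q)%:R : R[i])).
    rewrite -h; apply: eq_bigr => i _.
    by rewrite !mxE (mulrC _ (P i q)) complexRe_mulJ; ring.
  by case: (p == q).
Qed.

(** The sorted list of roots is a permutation of the [l i], so its first k entries come from some k
    indices. Their mere existence suffices, because the later estimate is uniform over all such
    index sets. *)
Lemma Pkminus_subset (R : realType) (n k : nat) (A : 'M[R]_n) (l : 'I_n -> R) :
  (k <= n)%N -> char_poly A = \prod_i ('X - (l i)%:P) ->
  exists2 S : {set 'I_n}, #|S| = k & Pkminus k A = \sum_(i in S) l i.
Proof.
move=> kn Al.
have : [set s : seq R | sorted <=%R s /\
          char_poly A = \prod_(x <- s) ('X - x%:P)] (eigseq A).
  (* A sorted factorisation exists, so [eigseq] is not the default [[::]]. *)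
  apply: xgetPex; exists (sort <=%R [seq l i | i <- enum 'I_n]); split.
    exact/sort_sorted/le_total.
  rewrite Al -big_enum/= -(big_map l xpredT (fun x => 'X - x%:P)).
  by apply: perm_big; rewrite perm_sym perm_sort.
move=> [_]; rewrite Al -big_enum/= -(big_map l xpredT (fun x => 'X - x%:P)).
move=> /prod_XsubC_eq; rewrite perm_sym => /(perm_iotaP 0)[Is].
rewrite size_map size_enum_ord => Isp eigE.
have Isn : size Is = n by rewrite (perm_size Isp) size_iota.
have Isu : uniq Is by rewrite (perm_uniq Isp) iota_uniq.
have Ilt j : j \in Is -> (j < n)%N by rewrite (perm_mem Isp) mem_iota.
exists (finset (fun i : 'I_n => val i \in take k Is)).
  rewrite cardE -(size_map val) -[RHS](_ : size (take k Is) = k); last first.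
    by rewrite size_takel// Isn.
  apply/perm_size/uniq_perm; rewrite ?take_uniq ?(map_inj_uniq val_inj) ?enum_uniq//.
  move=> j; apply/mapP/idP => [[i + ->]|jI]; first by rewrite mem_enum inE.
  by exists (Ordinal (Ilt j (mem_take jI))); rewrite // mem_enum inE.
rewrite /Pkminus.
have -> : \sum_(i < k) nth 0 (eigseq A) i = \sum_(x <- take k (eigseq A)) x.
  rewrite (big_nth 0) big_mkord size_takel; last by rewrite eigE size_map Isn.
  by apply: eq_bigr => i _; rewrite nth_take.
rewrite eigE -map_take big_map.
pose f j := nth 0 [seq l i | i <- enum 'I_n] j.
have fE (i : 'I_n) : f i = l i.
  by rewrite /f (nth_map i) ?size_enum_ord// nth_ord_enum.
under [RHS]eq_bigr do rewrite -fE.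
rewrite -big_enum/= -(big_map val xpredT f).
apply/perm_big/uniq_perm; rewrite ?take_uniq ?(map_inj_uniq val_inj) ?enum_uniq//.
move=> j; apply/idP/mapP => [jI|[i + ->]]; last by rewrite mem_enum inE.
by exists (Ordinal (Ilt j (mem_take jI))); rewrite // mem_enum inE.
Qed.

                              

(** * One-variable calculus *)

Lemma is_derive1_continuous (R : realType) (g : R -> R) (d x : R) :
  is_derive x 1 g d -> {for x, continuous g}.
Proof. by move=> [gd _]; apply/differentiable_continuous/derivable1_diffP. Qed.

Lemma MVT_between (R : realType) (g dg : R -> R) (a b : R) :
  (forall s : R, is_derive s 1 g (dg s)) ->
  exists2 c, `|c - a| <= `|b - a| & g b - g a = dg c * (b - a).
Proof.
move=> gdg; wlog ab : a b g dg gdg / a <= b => [hw|].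
  have [/hw|ba] := leP a b; first exact.
  have gdgN (s : R) : is_derive s 1 (fun u => g (- u)) (- dg (- s)).
    rewrite -mulrN1; apply: is_derive1_comp.
  have [|c cb E] := hw (- a) (- b) _ _ gdgN; first by rewrite lerN2 ltW.
  exists (- c); last by rewrite !opprK in E; rewrite E; ring.
  by move: cb; rewrite -!opprD !normrN opprK; lra.
have [|c + E] := @MVT_segment _ g dg _ _ ab (fun x _ => gdg x).
  by apply: continuous_subspaceT => x; exact: is_derive1_continuous (gdg x).
rewrite in_itv/= => /andP[ac cb]; exists c => //.
by rewrite !ger0_norm ?subr_ge0// lerD2r.
Qed.

Lemma is_derive1_lt0_right (R : realType) (g : R -> R) (l : R) :
  is_derive (0 : R) 1 g l -> g 0 = 0 -> l < 0 ->
  exists2 d, 0 < d & forall t, 0 < t -> t < d -> g t < 0.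
Proof.
move=> [gd gl] g0 l0.
have : h^-1 *: (g (h *: 1 + 0) - g 0) @[h --> 0^'] --> l.
  by rewrite -gl; exact: gd.
have Nl0 : 0 < - l by rewrite oppr_gt0.
move=> /cvgrPdist_lt/(_ _ Nl0); rewrite near_withinE => /nbhs_normP[d /= d0 hd].
exists d => // t t0 td.
have := hd t; rewrite /= sub0r normrN gtr0_norm// => /(_ td (lt0r_neq0 t0)).
rewrite g0 subr0 addr0 [_%:A]mulr1 distrC ltr_norml => /andP[_].
by rewrite ltrBlDr addNr [_ *: _]mulrC pmulr_llt0// invr_gt0.
Qed.

(** If [u2] were negative, [u1] would be negative just to the right of 0, and the mean value theorem
    would give a value of [u] below [u 0]. *)
Lemma local_min_derive2 (R : realType) (u u1 : R -> R) (d u2 : R) : 0 < d ->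
  (forall t : R, `|t| < d -> is_derive t 1 u (u1 t)) -> is_derive (0 : R) 1 u1 u2 ->
  (forall t, `|t| < d -> u 0 <= u t) -> u1 0 = 0 /\ 0 <= u2.
Proof.
move=> d0 ud u1d umin.
have inN t : t \in `]- d, d[ -> `|t| < d by rewrite in_itv/= ltr_norml.
have u10 : u1 0 = 0.
  have Nd0 : - d < 0 by rewrite oppr_lt0.
  have d0in : 0 \in `]- d, d[ by rewrite in_itv/= Nd0 d0.
  have [|_ <-] := ud 0; first by rewrite normr0.
  have [_ ->//] := derive1_at_min (ltW (lt_trans Nd0 d0))
    (fun t tin => @ex_derive _ _ _ _ _ _ _ (ud t (inN t tin))) d0in
    (fun t tin => umin t (inN t tin)).
split=> //; rewrite leNgt; apply/negP => u2lt0.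
have [e e0 u1e] := is_derive1_lt0_right u1d u10 u2lt0.
pose t := Num.min d e / 2.
have m0 : 0 < Num.min d e by rewrite lt_min d0.
have t0 : 0 < t by rewrite divr_gt0.
have td : t < d.
  by apply: (@lt_le_trans _ _ (Num.min d e)); rewrite ?ge_min ?lexx// /t; lra.
have te : t < e.
  apply: (@lt_le_trans _ _ (Num.min d e)); rewrite ?ge_min ?lexx ?orbT// /t; lra.
have abst s : 0 <= s -> s <= t -> `|s| < d.
  by move=> s0 st; rewrite ger0_norm// (le_lt_trans st).
have [x /[!in_itv]/=/andP[x0 xt]||c /[!in_itv]/=/andP[c0 ct] E] := @MVT _ u u1 0 t t0.
- by apply: ud; rewrite abst// ltW.
- apply: derivable_within_continuous => x /[!in_itv]/=/andP[x0 xt].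
  by have [] := ud _ (abst _ x0 xt).
have := umin t (abst t (ltW t0) (lexx _)).
rewrite -subr_ge0 E subr0 pmulr_lge0// leNgt => /negP; apply.
by rewrite u1e// (lt_trans ct).
Qed.

(** * Directional derivatives and Hessians of C2 functions *)

Section lines.
Context {R : realType} {n : nat}.
Implicit Types (f phi : 'rV[R]_n -> R) (x v y : 'rV[R]_n).

Lemma is_derive_line f x v (t l : R) : is_derive (t *: v + x) v f l ->
  is_derive t 1 (fun s => f (s *: v + x)) l.
Proof.
have E : (fun h : R => h^-1 *: (((fun s => f (s *: v + x)) \o shift t) (h *: 1) -
    f (t *: v + x))) =
  (fun h : R => h^-1 *: ((f \o shift (t *: v + x)) (h *: v) - f (t *: v + x))).
  by apply/funext => h /=; rewrite [_%:A]mulr1 scalerDl addrA.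
by move=> [fd fl]; split; rewrite /derivable /derive E.
Qed.

Lemma near_norm_lt x (P : 'rV[R]_n -> Prop) : (\forall y \near x, P y) ->
  exists2 d, 0 < d & forall y, `|y - x| < d -> P y.
Proof.
move=> /nbhs_normP[d /= d0 dP]; exists d => // y yx.
by apply: dP; rewrite /= distrC.
Qed.

                                                                     
                                       
(** Directional differentiability, uniform in the base point near [x]. Unlike the plain directional
    derivative, this notion is additive in the direction, which is how continuous partial
    derivatives yield derivatives in every direction. *)
Definition strict_dir f x v (l : R) := forall e : R, 0 < e ->
  exists2 d : R, 0 < d & forall y (t : R), `|y - x| < d -> `|t| < d ->
    `|f (t *: v + y) - f y - t * l| <= e * `|t|.

Lemma strict_dirD f x v1 v2 (l1 l2 : R) :
  strict_dir f x v1 l1 -> strict_dir f x v2 l2 ->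
  strict_dir f x (v1 + v2) (l1 + l2).
Proof.
move=> s1 s2 e e0; have e20 : 0 < e / 2 by rewrite divr_gt0.
have [d1 d10 h1] := s1 _ e20; have [d2 d20 h2] := s2 _ e20.
pose c := 1 + `|v2|; have c1 : 1 <= c by rewrite lerDl.
have c0 : 0 < c by lra.
(* The first increment is based at [t *: v2 + y]; the division by [c] keeps this point within [d1]
   of [x]. *)
pose d := Num.min (d1 / 2 / c) d2; exists d.
  by rewrite lt_min d20 !divr_gt0.
move=> y t; rewrite !lt_min => /andP[y1 y2] /andP[t1 t2].
have d1c : d1 / 2 / c <= d1 / 2 by rewrite ler_pdivrMr// ler_peMr// divr_ge0// ltW.
have -> : f (t *: (v1 + v2) + y) - f y - t * (l1 + l2) =
    (f (t *: v1 + (t *: v2 + y)) - f (t *: v2 + y) - t * l1) +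
    (f (t *: v2 + y) - f y - t * l2) by rewrite (addrA (t *: v1)) scalerDr; ring.
have -> : e * `|t| = e / 2 * `|t| + e / 2 * `|t| by field.
apply: (le_trans (ler_normD _ _)); apply: lerD; last exact: h2.
apply: h1; last lra.
rewrite -addrA (le_lt_trans (ler_normD _ _))// normrZ.
have : `|t| * `|v2| <= `|t| * c by rewrite ler_wpM2l// lerDr.
move: t1; rewrite ltr_pdivlMr//; lra.
Qed.

Lemma strict_dir_sum f x (I : finType) (v : I -> 'rV[R]_n) (l : I -> R) :
  (forall i, strict_dir f x (v i) (l i)) ->
  strict_dir f x (\sum_i v i) (\sum_i l i).
Proof.
move=> fv; elim/big_rec2: _ => [e e0|i l' v' _]; last exact: strict_dirD.
exists 1 => // y t _ _.
by rewrite scaler0 add0r mulr0 !subrr normr0 mulr_ge0// ltW.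
Qed.

(** By the mean value theorem on the line through y, the error is [t * a] times the change of the
    derivative between [x] and a nearby point. *)
Lemma strict_dirZ f x v (a : R) : (forall y, derivable f y v) ->
  {for x, continuous (fun y => derive f y v)} ->
  strict_dir f x (a *: v) (a * derive f x v).
Proof.
move=> fd fc e e0; pose b := 1 + `|a|; have b0 : 0 < b by rewrite ltr_wpDr.
have eb : 0 < e / b by rewrite divr_gt0.
move: fc => /cvgrPdist_lt/(_ _ eb)/near_norm_lt[d d0 hd].
pose c := 1 + `|a| * `|v|; have c0 : 0 < c by rewrite ltr_wpDr ?mulr_ge0.
have c1 : 1 <= c by rewrite lerDl mulr_ge0.
exists (d / 2 / c); first by rewrite !divr_gt0.
move=> y t yx; rewrite ltr_pdivlMr// => td.
have d1c : d / 2 / c <= d / 2 by rewrite ler_pdivrMr// ler_peMr// divr_ge0// ltW.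
have line (s : R) : is_derive s 1 (fun s => f (s *: v + y)) (derive f (s *: v + y) v).
  by apply: is_derive_line; apply: derivableP.
have [s] := MVT_between 0 (t * a) line.
rewrite !subr0 scale0r add0r scalerA normrM => ts ->.
have sd : `|s *: v + y - x| < d.
  rewrite -addrA (le_lt_trans (ler_normD _ _))// normrZ.
  have : `|s| * `|v| <= `|t| * `|a| * `|v| by rewrite ler_wpM2r.
  have : `|t| * c = `|t| + `|t| * `|a| * `|v| by rewrite /c; ring.
  have : 0 <= `|t| by [].
  lra.
have -> : derive f (s *: v + y) v * (t * a) - t * (a * derive f x v) =
    (t * a) * (derive f (s *: v + y) v - derive f x v) by ring.
rewrite normrM normrM distrC.
have := hd _ sd; rewrite ltr_pdivlMr// => {}hd.
rewrite -mulrA (mulrC e) ler_wpM2l//; apply: le_trans (ltW hd).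
rewrite mulrC ler_wpM2l//; rewrite /b; lra.
Qed.

Lemma strict_dir_is_derive f x v (l : R) : strict_dir f x v l ->
  is_derive x v f l.
Proof.
move=> fs.
have cv : (fun h => h^-1 *: ((f \o shift x) (h *: v) - f x)) @ 0^' --> l.
  apply/cvgrPdist_le => e e0; have [d d0 hd] := fs _ e0.
  rewrite near_withinE; apply/nbhs_normP; exists d => //= t; rewrite /= sub0r normrN.
  move=> td t0; have := hd x t; rewrite subrr normr0 => /(_ d0 td) {}hd.
  rewrite distrC -(ler_pM2r (_ : 0 < `|t|)) ?normr_gt0//; apply: (le_trans _ hd).
  by rewrite -normrM mulrBl [_ *: _]mulrC mulfVK// (mulrC t) lexx.
by split; [apply/cvg_ex; exists l | exact/cvg_lim].
Qed.

Lemma is_derive_partials f x v : (forall y i, derivable f y (ebasis R i)) ->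
  (forall i, {for x, continuous (fun y => derive f y (ebasis R i))}) ->
  is_derive x v f (\sum_i v 0 i * derive f x (ebasis R i)).
Proof.
move=> fd fc; apply: strict_dir_is_derive.
rewrite {1}(row_sum_delta v); apply: strict_dir_sum => i.
by apply: strict_dirZ => [y|]; [exact: fd | exact: fc].
Qed.

Definition quad (A : 'M[R]_n) v := \sum_p \sum_q A p q * (v 0 p * v 0 q).

(** [C2] speaks of coordinate directions only; this transfers it to arbitrary lines, up to second
    order. *)
Lemma C2_line phi x v (t : R) : C2 phi ->
  is_derive t 1 (fun s => phi (s *: v + x))
    (\sum_i v 0 i * grad phi (t *: v + x) 0 i) /\
  is_derive t 1 (fun s => \sum_i v 0 i * grad phi (s *: v + x) 0 i)
    (quad (hess phi (t *: v + x)) v).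
Proof.
move=> [_ [d1 [c1 [d2 c2]]]]; split.
  apply: is_derive_line; under eq_bigr do rewrite mxE.
  by apply: is_derive_partials => // i; exact: c1.
pose g i (s : R) := v 0 i * grad phi (s *: v + x) 0 i.
have -> : (fun s => \sum_i v 0 i * grad phi (s *: v + x) 0 i) = \sum_i g i.
  by apply/funext => s; rewrite fct_sumE.
rewrite /quad exchange_big; apply: is_derive_sum => q.
have : is_derive t 1 (fun s => derive phi (s *: v + x) (ebasis R q))
  (\sum_i v 0 i * hess phi (t *: v + x) i q).
  apply: (is_derive_line (f := fun y => derive phi y (ebasis R q))); under eq_bigr do rewrite mxE.
  by apply: is_derive_partials => [y i|i]; [exact: d2|exact: c2].
move=> /(is_deriveZ (v 0 q)).
have -> : v 0 q *: (\sum_i v 0 i * hess phi (t *: v + x) i q) =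
   \sum_i hess phi (t *: v + x) i q * (v 0 i * v 0 q).
  by rewrite scaler_sumr; apply: eq_bigr => i _; rewrite [_ *: _]mulrC; ring.
suff -> : (v 0 q \*: (fun s => derive phi (s *: v + x) (ebasis R q))) = g q by [].
by apply/funext => s; rewrite /g mxE.
Qed.

(** Two applications of the mean value theorem, in direction i and then in direction j, turn the
    second difference over a small parallelogram into [t ^+ 2] times a mixed derivative at a nearby
    point. *)
Lemma C2_mixed_increment phi x i j (e : R) : C2 phi -> 0 < e ->
  exists2 d, 0 < d & forall t : R, 0 < t -> t < d ->
  `|(phi (t *: ebasis R i + (t *: ebasis R j + x)) - phi (t *: ebasis R i + x)
    - phi (t *: ebasis R j + x) + phi x) - hess phi x j i * t ^+ 2| <= e * t ^+ 2.
Proof.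
move=> [_ [d1 [c1 [d2 c2]]]] e0.
move: (c2 j i x) => /cvgrPdist_lt/(_ _ e0)/near_norm_lt[d d0 hd].
pose c := 1 + `|ebasis R i| + `|ebasis R j|.
have c1' : 1 <= c by rewrite /c -addrA lerDl addr_ge0.
have c0 : 0 < c by lra.
exists (d / c) => [|t t0]; rewrite ?divr_gt0// ltr_pdivlMr// => td.
pose F (s : R) := phi (s *: ebasis R i + (t *: ebasis R j + x)) - phi (s *: ebasis R i + x).
have Fd (s : R) : is_derive s 1 F
    (derive phi (s *: ebasis R i + (t *: ebasis R j + x)) (ebasis R i) -
     derive phi (s *: ebasis R i + x) (ebasis R i)).
  by apply: is_deriveB; apply: is_derive_line; apply: derivableP.
have [s] := MVT_between 0 t Fd; rewrite !subr0 => st FE.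
have Gd (u : R) : is_derive u 1
   (fun u => derive phi (u *: ebasis R j + (s *: ebasis R i + x)) (ebasis R i))
   (hess phi (u *: ebasis R j + (s *: ebasis R i + x)) j i).
  rewrite mxE.
  by apply: (is_derive_line (f := fun y => derive phi y (ebasis R i))); apply: derivableP.
have [u] := MVT_between 0 t Gd; rewrite !subr0 => ut GE.
have {}FE : F t - F 0 = hess phi (u *: ebasis R j + (s *: ebasis R i + x)) j i * t ^+ 2.
  by rewrite FE expr2 mulrA -GE scale0r add0r addrCA.
have -> : phi (t *: ebasis R i + (t *: ebasis R j + x)) - phi (t *: ebasis R i + x)
    - phi (t *: ebasis R j + x) + phi x = F t - F 0.
  by rewrite /F !scale0r !add0r; ring.
rewrite FE -mulrBl normrM (ger0_norm (sqr_ge0 t)) ler_wpM2r ?sqr_ge0//.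
rewrite distrC !mxE; apply/ltW/hd; rewrite addrA addrK.
rewrite (le_lt_trans (ler_normD _ _))// !normrZ.
move: st ut; rewrite (gtr0_norm t0) => st ut.
have := ler_wpM2r (normr_ge0 (ebasis R i)) st.
have := ler_wpM2r (normr_ge0 (ebasis R j)) ut.
have : t * c = t + t * `|ebasis R i| + t * `|ebasis R j| by rewrite /c; ring.
lra.
Qed.

(** The second difference is symmetric in i and j, so both mixed derivatives approximate the same
    quantity. *)
Lemma hess_sym phi x : C2 phi -> (hess phi x)^T = hess phi x.
Proof.
move=> phiC2; apply/matrixP => i j; rewrite mxE.
apply/eqP; rewrite -subr_eq0 -normr_le0 leNgt; apply/negP => D0.
(* With a quarter of the gap as tolerance, the two errors add up to half of the gap only, which is
   absurd. *)
pose e := `|hess phi x j i - hess phi x i j| / 4.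
have e0 : 0 < e by rewrite divr_gt0.
have [d1 d10 h1] := C2_mixed_increment x i j phiC2 e0.
have [d2 d20 h2] := C2_mixed_increment x j i phiC2 e0.
pose t := Num.min d1 d2 / 2.
have m0 : 0 < Num.min d1 d2 by rewrite lt_min d10.
have t0 : 0 < t by rewrite divr_gt0.
have td1 : t < d1.
  by apply: (@lt_le_trans _ _ (Num.min d1 d2)); rewrite ?ge_min ?lexx// /t; lra.
have td2 : t < d2.
  apply: (@lt_le_trans _ _ (Num.min d1 d2)); rewrite ?ge_min ?lexx ?orbT// /t; lra.
have := h1 t t0 td1; have := h2 t t0 td2.
have -> : t *: ebasis R j + (t *: ebasis R i + x) =
  t *: ebasis R i + (t *: ebasis R j + x) by rewrite addrCA.
set a := phi (_ + (_ + x)); set b := phi (t *: ebasis R i + x).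
set c := phi (t *: ebasis R j + x).
rewrite [a - c - b]addrAC.
set D := _ + phi x => H2 H1.
have : `|hess phi x j i - hess phi x i j| * t ^+ 2 <= 2 * e * t ^+ 2.
  have -> : `|hess phi x j i - hess phi x i j| * t ^+ 2 =
     `|(D - hess phi x i j * t ^+ 2) - (D - hess phi x j i * t ^+ 2)|.
    rewrite -[t ^+ 2 in LHS]ger0_norm ?sqr_ge0// -normrM; congr `|_|; ring.
  apply: (le_trans (ler_normB _ _)); lra.
rewrite ler_pM2r ?exprn_gt0//; move: D0 e0; rewrite /e; lra.
Qed.

End lines.

                        

(** * Euclidean norm and its smooth regularisation *)

Section euclidean.
Context {R : realType} {n : nat}.
Implicit Types (u v x y z : 'rV[R]_n).

Definition dot x y : R := \sum_i x 0 i * y 0 i.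

Lemma dotC x y : dot x y = dot y x.
Proof. by apply: eq_bigr => i _; rewrite mulrC. Qed.

Lemma dotDl x y z : dot (x + y) z = dot x z + dot y z.
Proof.
by rewrite -big_split; apply: eq_bigr => i _; rewrite mxE mulrDl.
Qed.

Lemma dotZl (a : R) x y : dot (a *: x) y = a * dot x y.
Proof. by rewrite mulr_sumr; apply: eq_bigr => i _; rewrite mxE mulrA. Qed.

Lemma dot_ge0 x : 0 <= dot x x.
Proof. by apply: sumr_ge0 => i _; rewrite -expr2 sqr_ge0. Qed.

Lemma enorm_ge0 x : 0 <= enorm x.
Proof. exact: sqrtr_ge0. Qed.

Lemma enormE x : enorm x = Num.sqrt (dot x x).
Proof. by []. Qed.

Lemma sqr_enorm x : enorm x ^+ 2 = dot x x.
Proof. by rewrite enormE sqr_sqrtr// dot_ge0. Qed.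

Lemma enormZ (a : R) x : enorm (a *: x) = `|a| * enorm x.
Proof.
by rewrite !enormE dotZl dotC dotZl mulrA -expr2 sqrtrM ?sqr_ge0// sqrtr_sqr.
Qed.

Lemma enorm0 : enorm (0 : 'rV[R]_n) = 0.
Proof. by rewrite -(scale0r 0) enormZ normr0 mul0r. Qed.

Lemma enormN x : enorm (- x) = enorm x.
Proof. by rewrite -scaleN1r enormZ normrN1 mul1r. Qed.

Lemma enormBC x y : enorm (x - y) = enorm (y - x).
Proof. by rewrite -enormN opprB. Qed.

Lemma enorm_eq0 x : enorm x = 0 -> x = 0.
Proof.
move=> x0; apply/rowP => i; rewrite mxE; apply/eqP; rewrite -sqrf_eq0 expr2.
have := sqr_enorm x; rewrite x0 expr0n/= => /esym.
by move=> /psumr_eq0P -> // j _; rewrite -expr2 sqr_ge0.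
Qed.

Lemma dot_le_enorm x y : dot x y <= enorm x * enorm y.
Proof.
have dot0 z : dot 0 z = 0 by rewrite -(scale0r 0) dotZl mul0r.
have [/enorm_eq0 ->|x0] := eqVneq (enorm x) 0; first by rewrite dot0 enorm0 mul0r.
have [/enorm_eq0 ->|y0] := eqVneq (enorm y) 0.
  by rewrite dotC dot0 enorm0 mulr0.
have x1 : 0 < enorm x by rewrite lt_def x0 enorm_ge0.
have y1 : 0 < enorm y by rewrite lt_def y0 enorm_ge0.
(* Cauchy-Schwarz, from the squared norm of |y| x - |x| y. *)
have : 0 <= dot (enorm y *: x + (- enorm x) *: y) (enorm y *: x + (- enorm x) *: y).
  exact: dot_ge0.
rewrite dotDl !dotZl !(dotC _ (_ + _)) !dotDl !dotZl -!sqr_enorm (dotC y x).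
have -> : forall a b d : R, a * (a * b ^+ 2 + - b * d) + - b * (a * d + - b * a ^+ 2)
  = (2 * (a * b)) * (b * a - d) by move=> a b d; ring.
by rewrite pmulr_rge0 ?mulr_gt0// subr_ge0.
Qed.

Lemma ler_enormD x y : enorm (x + y) <= enorm x + enorm y.
Proof.
rewrite -(@ler_pXn2r _ 2) ?nnegrE ?addr_ge0 ?enorm_ge0//.
rewrite sqr_enorm dotDl !(dotC _ (x + y)) !dotDl -!sqr_enorm (dotC y x).
by have := dot_le_enorm x y; lra.
Qed.

Lemma ler_enormB x y z : enorm (x - z) <= enorm (x - y) + enorm (y - z).
Proof. by have := ler_enormD (x - y) (y - z); rewrite addrA subrK. Qed.

Lemma ler_enorm_sum (I : finType) (F : I -> 'rV[R]_n) :
  enorm (\sum_i F i) <= \sum_i enorm (F i).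
Proof.
elim/big_rec2: _ => [|i a v _ av]; first by rewrite enorm0.
by apply: (le_trans (ler_enormD _ _)); rewrite lerD2l.
Qed.

(** Comparison with the sup norm that carries the topology of row vectors; it makes Euclidean balls
    neighbourhoods. *)
Lemma enorm_le_norm x : enorm x <= n%:R * `|x|.
Proof.
have h i : enorm (x 0 i *: 'e_i) <= `|x|.
  rewrite enormZ; have -> : enorm ('e_i : 'rV[R]_n) = 1.
    rewrite enormE /dot (bigD1 i)//= big1 => [|j ji]; rewrite !mxE ?eqxx.
      by rewrite mul1r addr0 sqrtr1.
    by rewrite (negPf ji) mulr0.
  rewrite mulr1 [leRHS]/Num.norm/= mx_normrE.
  by rewrite (le_bigmax _ (fun ij : 'I_1 * 'I_n => `|x ij.1 ij.2|) (0, i)).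
rewrite {1}(row_sum_delta x); apply: (le_trans (ler_enorm_sum _)).
apply: (le_trans (ler_sum _ (fun i _ => h i))).
by rewrite sumr_const card_ord mulr_natl.
Qed.

Lemma nbhs_eball x (r : R) : 0 < r -> nbhs x (eball x r).
Proof.
move=> r0; have n0 : 0 < n%:R + 1 :> R by rewrite ltr_wpDl.
suff : \forall y \near x, eball x r y by [].
apply/nbhs_normP; exists (r / (n%:R + 1)); first by rewrite /= divr_gt0.
move=> y /=; rewrite ltr_pdivlMr// distrC => h; rewrite /eball/=.
apply: (le_lt_trans (enorm_le_norm _)).
apply: le_lt_trans h; rewrite mulrDr mulr1 mulrC lerDl//.
Qed.

Lemma open_eball x (r : R) : open (eball x r).
Proof.
rewrite openE => y; rewrite /eball/= => yr; rewrite /interior.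
apply: filterS (@nbhs_eball y (r - enorm (y - x)) _); last by rewrite subr_gt0.
move=> z; rewrite /eball/= ltrBrDr; apply: le_lt_trans.
exact: ler_enormB.
Qed.

                                                                                 
(** The distance to a centre, smoothed at scale r. The extra r^2 under the root is the source of the
    strict gain in [kern_lower]. *)
Definition regnorm (r : R) x : R := Num.sqrt (dot x x + r ^+ 2).

Lemma sqr_regnorm (r : R) x : regnorm r x ^+ 2 = enorm x ^+ 2 + r ^+ 2.
Proof. by rewrite sqr_sqrtr ?addr_ge0 ?dot_ge0 ?sqr_ge0// sqr_enorm. Qed.

Lemma regnorm_ge0 (r : R) x : 0 <= regnorm r x.
Proof. exact: sqrtr_ge0. Qed.

Lemma le_regnorm (r : R) x : 0 <= r -> r <= regnorm r x.
Proof.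
move=> r0; rewrite -(@ler_pXn2r _ 2) ?nnegrE ?regnorm_ge0// sqr_regnorm.
by rewrite lerDr sqr_ge0.
Qed.

Lemma enorm_le_regnorm (r : R) x : enorm x <= regnorm r x.
Proof.
rewrite -(@ler_pXn2r _ 2) ?nnegrE ?regnorm_ge0 ?enorm_ge0// sqr_regnorm.
by rewrite lerDl sqr_ge0.
Qed.

Lemma regnorm_le (r : R) x : 0 <= r -> regnorm r x <= enorm x + r.
Proof.
move=> r0; rewrite -(@ler_pXn2r _ 2) ?nnegrE ?regnorm_ge0 ?addr_ge0 ?enorm_ge0//.
rewrite sqr_regnorm; have := mulr_ge0 (enorm_ge0 x) r0; lra.
Qed.

Lemma regnorm_lip (r : R) x y : regnorm r (x + y) <= regnorm r x + enorm y.
Proof.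
rewrite -(@ler_pXn2r _ 2) ?nnegrE ?regnorm_ge0 ?addr_ge0 ?enorm_ge0 ?regnorm_ge0//.
rewrite sqr_regnorm sqr_enorm dotDl !(dotC _ (x + y)) !dotDl -!sqr_enorm (dotC y x).
rewrite sqrrD sqr_regnorm.
have := dot_le_enorm x y.
have := ler_wpM2r (enorm_ge0 y) (enorm_le_regnorm r x).
lra.
Qed.

Lemma regnorm_line_is_derive (r : R) x v (t : R) : 0 < r ->
  is_derive t 1 (fun s => regnorm r (s *: v + x))
    ((t * dot v v + dot x v) / regnorm r (t *: v + x)).
Proof.
move=> r0.
have q0 s : 0 < dot (s *: v + x) (s *: v + x) + r ^+ 2.
  by rewrite ltr_wpDl ?dot_ge0// exprn_gt0.
have qE : (fun s : R => dot (s *: v + x) (s *: v + x) + r ^+ 2) =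
    (fun s => (s * s) * dot v v + (s * (2 * dot x v) + (dot x x + r ^+ 2))).
  apply/funext => s; rewrite dotDl !(dotC _ (s *: v + x)) !dotDl !dotZl.
  by rewrite (dotC v (s *: v)) (dotC v x) (dotC x (s *: v)) !dotZl (dotC v x); ring.
have qd : is_derive t 1 (fun s : R => dot (s *: v + x) (s *: v + x) + r ^+ 2)
   (2 * (t * dot v v + dot x v)).
  rewrite qE; apply: is_derive_eq.
  by rewrite /GRing.scale/=; ring.
have := @is_derive1_comp _ Num.sqrt
  (fun s => dot (s *: v + x) (s *: v + x) + r ^+ 2) t _ _ (is_derive1_sqrt (q0 t)) qd.
rewrite [X in is_derive _ _ X _](_ : _ = (fun s => regnorm r (s *: v + x)))//.
move=> h; apply: (is_derive_eq h).
rewrite -/(regnorm r (t *: v + x)).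
have : regnorm r (t *: v + x) != 0 by rewrite gt_eqF// (lt_le_trans r0) ?le_regnorm// ltW.
by move=> ?; field.
Qed.

End euclidean.

(** * The radial profile attached to one ball *)

Lemma is_derive1_ge0_le (R : realType) (g dg : R -> R) (a b : R) : a <= b ->
  (forall t : R, a <= t -> t <= b -> is_derive t 1 g (dg t)) ->
  (forall t, a <= t -> t <= b -> 0 <= dg t) -> g a <= g b.
Proof.
move=> ab gd dg0.
have [x /[!in_itv]/=/andP[ax xb]||c /[!in_itv]/=/andP[ac cb] E] :=
  @MVT_segment _ g dg a b ab.
- by apply: gd; exact: ltW.
- apply: derivable_within_continuous => x /[!in_itv]/=/andP[ax xb].
  by have [] := gd _ ax xb.
by rewrite -subr_ge0 E mulr_ge0 ?dg0// subr_ge0.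
Qed.

Lemma antiderivative (R : realType) (f : R -> R) (a b : R) :
  (forall t, a <= t -> t <= b -> {for t, continuous f}) ->
  exists G : R -> R, forall t : R, a < t -> t < b -> is_derive t 1 G (f t).
Proof.
move=> fc; exists (fun x => \int[lebesgue_measure]_(t in `[a, x]) f t) => t at_ tb.
have [||Fd FE] := @continuous_FTC1_closed R f a t b tb _ at_.
- apply: continuous_compact_integrable; first exact: segment_compact.
  apply: continuous_in_subspaceT => x; rewrite inE/= in_itv/= => /andP[ax xb].
  exact: fc.
- by apply: fc; exact: ltW.
by split; [exact: Fd | rewrite -derive1E; exact: FE].
Qed.

Section profile.
Context {R : realType}.
Variables (k : nat) (h : R).

(** This is G'(t)/t for the profile G with G'' + (k-1)G'/t = h G', scaled by r^k so that it is of
    order one near t = r. *)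
Definition kern (r t : R) : R := (r / t) ^+ k * expR (h * t).

Lemma kern_ge0 (r t : R) : 0 < r -> 0 < t -> 0 <= kern r t.
Proof. by move=> r0 t0; rewrite mulr_ge0 ?expR_ge0// exprn_ge0// divr_ge0// ltW. Qed.

Lemma is_derive_kern (r t : R) : (0 < k)%N -> 0 < t ->
  is_derive t 1 (kern r) (kern r t * (h - k%:R / t)).
Proof.
move=> k0 t0; have tn0 : t != 0 by rewrite gt_eqF.
have d1 : is_derive t 1 (fun s : R => r * s^-1) (- r / t ^+ 2).
  have := is_deriveZ r (is_deriveV tn0 (is_derive_id t 1)).
  move=> H; apply: (is_derive_eq H).
  by rewrite /GRing.scale/=; field.
have d2 : is_derive t 1 (fun s : R => expR (h * s)) (expR (h * t) * h).
  apply: (@is_derive1_comp _ expR (fun s => h * s)).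
  have := is_deriveZ h (is_derive_id t 1) => H; apply: (is_derive_eq H).
  by rewrite /GRing.scale/= mulr1.
have -> : kern r = (fun s => r * s^-1) ^+ k * (fun s => expR (h * s)).
  by rewrite !fctE.
have := is_deriveM (is_deriveX k d1) d2 => H; apply: (is_derive_eq H).
rewrite /kern /GRing.scale/= !fctE.
case: k k0 => // m _; rewrite /= !exprS.
by field.
Qed.

(** Origin of the cases of [PsiK]: a primitive of r^k t^{1-k} is linear for k = 1, logarithmic for k
    = 2, and a decaying power for k >= 3. *)
Lemma PsiK_antiderivative (r : R) : (0 < k)%N -> 0 < r -> exists B : R -> R,
  (forall t : R, 0 < t -> is_derive t 1 B (t * (r / t) ^+ k)) /\
  (forall Rr, r < Rr -> B Rr - B r <= PsiK k Rr r).
Proof.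
rewrite /PsiK; case: k => [//|[|[|m]]] _ r0 /=.
- exists (fun t => r * t); split=> [t t0|Rr rR].
    have := is_deriveZ r (is_derive_id t 1) => H; apply: (is_derive_eq H).
    by rewrite /GRing.scale/= mulr1 expr1; field; rewrite gt_eqF.
  by rewrite mulrC lerBlDr lerDl mulr_ge0// ltW.
- exists (fun t => r ^+ 2 * ln t); split=> [t t0|Rr rR].
    have := is_deriveZ (r ^+ 2) (is_derive1_ln t0) => H; apply: (is_derive_eq H).
    by rewrite /GRing.scale/=; field; rewrite gt_eqF.
  have R0 : 0 < Rr by exact: lt_trans rR.
  by rewrite -mulrBr -ln_div ?posrE// ler_wpM2l ?sqr_ge0// ler_norm.
(* Here k = m + 3 and [c] is 1/(k-2), which is at most 1. *)
pose c : R := (m.+1)%:R^-1.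
exists (fun t => (- (c * r ^+ m.+3)) * (t^-1) ^+ m.+1); split=> [t t0|Rr rR].
  have tn0 : t != 0 by rewrite gt_eqF.
  have -> : (fun t : R => - (c * r ^+ m.+3) * t^-1 ^+ m.+1) =
      - (c * r ^+ m.+3) \*: ((fun t => t^-1) ^+ m.+1).
    by apply/funext => s; rewrite !fctE.
  have := is_deriveZ (- (c * r ^+ m.+3)) (is_deriveX m.+1
    (is_deriveV tn0 (is_derive_id t 1))) => H; apply: (is_derive_eq H).
  rewrite /GRing.scale/= /c exprMn !exprVn !exprS.
  have m1 : 1 + m%:R != 0 :> R by rewrite addrC natr1 pnatr_eq0.
  have tm : t ^+ m != 0 by rewrite expf_neq0.
  rewrite -natr1; field.
  by rewrite tm tn0 addrC m1.
have R0 : 0 < Rr by exact: lt_trans rR.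
rewrite -[leRHS]mul1r.
have -> : r ^+ 2 = r ^+ m.+3 * r^-1 ^+ m.+1.
  by rewrite exprVn -(addn2 m.+1) exprD mulrAC mulfV ?mul1r// expf_neq0// gt_eqF.
have c0 : 0 <= c by rewrite invr_ge0.
have c1 : c <= 1 by rewrite invf_le1 ?ler1n// ltr0n.
have p0 : 0 <= r ^+ m.+3 by rewrite exprn_ge0// ltW.
have q0 : 0 <= r^-1 ^+ m.+1 by rewrite exprn_ge0// invr_ge0 ltW.
have s0 : 0 <= Rr^-1 ^+ m.+1 by rewrite exprn_ge0// invr_ge0 ltW.
have := mulr_ge0 (mulr_ge0 c0 p0) s0.
have := ler_wpM2r (mulr_ge0 p0 q0) c1.
rewrite !mulNr opprK !mulrA; lra.
Qed.

                                                                                     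
(** G is increasing and normalised to vanish at [Rr], hence nonpositive. For the lower bound, e^{ht}
    <= e^{h Rr} compares G' with the integrand of [PsiK_antiderivative]. The interval of
    differentiability exceeds [r, Rr] so that its end points are interior. *)
Lemma profile_exists (r Rr : R) : (0 < k)%N -> 0 <= h -> 0 < r -> r < Rr ->
  exists G : R -> R,
  (forall t : R, r / 2 < t -> t < Rr + 1 -> is_derive t 1 G (t * kern r t)) /\
  (forall t, r <= t -> t <= Rr ->
     - (expR (h * Rr) * PsiK k Rr r) <= G t /\ G t <= 0).
Proof.
move=> k0 h0 r0 rR.
have [|G0 G0d] := @antiderivative R (fun t => t * kern r t) (r / 2) (Rr + 1).
  move=> t rt _; have t0 : 0 < t by apply: lt_le_trans rt; rewrite divr_gt0.
  have := is_deriveM (is_derive_id t 1) (is_derive_kern r k0 t0).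
  exact: is_derive1_continuous.
pose G t := G0 t - G0 Rr.
have Gd (t : R) : r / 2 < t -> t < Rr + 1 -> is_derive t 1 G (t * kern r t).
  move=> rt tR; have := is_deriveB (G0d t rt tR) (is_derive_cst (G0 Rr) t 1).
  by move=> H; apply: (is_derive_eq H); rewrite subr0.
have [B [Bd BPsi]] := PsiK_antiderivative k0 r0.
have Gmono (s t : R) : r <= s -> s <= t -> t <= Rr -> G s <= G t.
  move=> rs st tR; apply: (is_derive1_ge0_le (dg := fun t => t * kern r t)) => //.
    by move=> u su ut; apply: Gd; lra.
  move=> u su ut; have u0 : 0 < u by lra.
  by rewrite mulr_ge0 ?kern_ge0// ltW.
exists G; split => // t rt tR.
have GR : G Rr = 0 by rewrite /G subrr.
split; last by rewrite -GR Gmono.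
apply: (@le_trans _ _ (G r)); last by rewrite Gmono.
pose D t := expR (h * Rr) * B t - G t.
have : D r <= D Rr.
  apply: (is_derive1_ge0_le
    (dg := fun t => expR (h * Rr) * (t * (r / t) ^+ k) - t * kern r t)).
  - exact: ltW.
  - move=> u ru uR.
    have u0 : 0 < u by lra.
    have dB := is_deriveZ (expR (h * Rr)) (Bd u u0).
    have dG : is_derive u 1 G (u * kern r u) by apply: Gd; lra.
    exact: (is_deriveB dB dG).
  move=> u ru uR; have u0 : 0 < u by lra.
  rewrite subr_ge0 /kern [leRHS]mulrCA ler_wpM2l ?(ltW u0)// [leRHS]mulrC ler_wpM2l//.
    by rewrite exprn_ge0// divr_ge0// ltW.
  by rewrite ler_expR ler_wpM2l.
rewrite /D GR subr0 => DR.
have := ler_wpM2l (expR_ge0 (h * Rr)) (BPsi _ rR).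
rewrite mulrBr; lra.
Qed.

                                                                          
(** With e the distance to the centre, the right-hand side is the lower bound for the operator on
    G(T). Its bracket times 2T^2 equals 2k r^2 - 2hT e(T-e); since 2e(T-e) <= (T-e)(T+e) = r^2 and
    hT <= k, at least k r^2 remains. *)
Lemma kern_lower (r e T : R) : 0 < r -> 0 <= e -> 0 < T -> 0 <= h ->
  T ^+ 2 = e ^+ 2 + r ^+ 2 -> h * T <= k%:R ->
  kern r T * k%:R * r ^+ 2 / (2 * T ^+ 2) <=
  kern r T * (k%:R - (k%:R / T - h) / T * e ^+ 2 - h * e).
Proof.
move=> r0 e0 T0 h0 TE hT; have Tn0 : T != 0 by rewrite gt_eqF.
have -> : kern r T * k%:R * r ^+ 2 / (2 * T ^+ 2) =
  kern r T * (k%:R * (r ^+ 2 / (2 * T ^+ 2))) by rewrite !mulrA.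
rewrite ler_wpM2l ?kern_ge0//.
have T20 : 0 < T ^+ 2 by rewrite exprn_gt0.
rewrite -(ler_pM2r (_ : 0 < 2 * T ^+ 2)) ?mulr_gt0//.
have -> : k%:R * (r ^+ 2 / (2 * T ^+ 2)) * (2 * T ^+ 2) = k%:R * r ^+ 2 by field.
have -> : (k%:R - (k%:R / T - h) / T * e ^+ 2 - h * e) * (2 * T ^+ 2) =
   2 * k%:R * (T ^+ 2 - e ^+ 2) - 2 * h * T * e * (T - e) by field.
have -> : T ^+ 2 - e ^+ 2 = r ^+ 2 by rewrite TE; ring.
have eT : e <= T.
  by rewrite -(@ler_pXn2r _ 2) ?nnegrE// ?(ltW T0)// TE lerDl sqr_ge0.
have A : 2 * e * (T - e) <= r ^+ 2.
  have -> : r ^+ 2 = (T - e) * (T + e) by rewrite -[LHS](addKr (e ^+ 2)) -TE; ring.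
  by rewrite mulrC ler_wpM2l ?subr_ge0//; lra.
have hT0 : 0 <= h * T by rewrite mulr_ge0// ltW.
have := ler_wpM2l hT0 A; have := ler_wpM2r (sqr_ge0 r) hT.
lra.
Qed.

(** Inside the ball T^2 <= 2r^2, so r/T >= 1/2 and r^2/(2T^2) >= 1/4, while the exponential is at
    least 1. *)
Lemma kern_lower_near (r e T : R) : 0 < r -> 0 <= e -> 0 < T -> 0 <= h ->
  T ^+ 2 = e ^+ 2 + r ^+ 2 -> e < r ->
  k%:R / 4 / 2 ^+ k <= kern r T * k%:R * r ^+ 2 / (2 * T ^+ 2).
Proof.
move=> r0 e0 T0 h0 TE er; have Tn0 : T != 0 by rewrite gt_eqF.
have e2r2 : e ^+ 2 <= r ^+ 2 by rewrite lerXn2r ?nnegrE// ltW.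
have T2r : T <= 2 * r.
  rewrite -(@ler_pXn2r _ 2) ?nnegrE ?(ltW T0)//; last lra.
  by rewrite TE exprMn; have := sqr_ge0 r; lra.
have K : 2^-1 ^+ k <= kern r T.
  rewrite -[leLHS]mulr1 ler_pM// ?exprn_ge0//.
    apply: lerXn2r; rewrite ?nnegrE ?invr_ge0//; first by rewrite divr_ge0// ltW.
    by rewrite ler_pdivlMr// mulrC ler_pdivrMr// mulrC.
  by rewrite -expR0 ler_expR mulr_ge0// ltW.
have Q : 4^-1 <= r ^+ 2 / (2 * T ^+ 2).
  rewrite ler_pdivlMr ?mulr_gt0 ?exprn_gt0//.
  by rewrite TE; lra.
have -> : k%:R / 4 / 2 ^+ k = k%:R * (2^-1 ^+ k * 4^-1) :> R by rewrite exprVn; ring.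
have -> : kern r T * k%:R * r ^+ 2 / (2 * T ^+ 2) =
  k%:R * (kern r T * (r ^+ 2 / (2 * T ^+ 2))) by ring.
by rewrite ler_wpM2l// ler_pM// ?exprn_ge0.
Qed.

End profile.

                                          

(** * Test functions touching the potential from above *)

Lemma is_derive1_bigsum (R : realType) (I : finType) (F : I -> R -> R)
    (dF : I -> R) (t : R) : (forall i, is_derive t 1 (F i) (dF i)) ->
  is_derive t 1 (fun s => \sum_i F i s) (\sum_i dF i).
Proof.
move=> Fd; elim: (index_enum I) => [|i s IH].
  have -> : (fun s => \sum_(i <- [::]) F i s) = cst 0.
    by apply/funext => s; rewrite big_nil.
  by rewrite big_nil; exact: is_derive_cst.
have -> : (fun u => \sum_(i <- i :: s) F i u) =
    F i + (fun u => \sum_(i <- s) F i u).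
  by apply/funext => u; rewrite big_cons.
by rewrite big_cons; exact: is_deriveD.
Qed.

(** Parseval's identity for a real vector in a complex orthonormal basis given by real and imaginary
    parts. *)
Lemma sum_sqr_dot_rows (R : realType) (n : nat) (y : 'rV[R]_n) (a b : 'M[R]_n) :
  (forall p q, \sum_i (a i p * a i q + b i p * b i q) = (p == q)%:R) ->
  \sum_i (dot y (row i a) ^+ 2 + dot y (row i b) ^+ 2) = dot y y.
Proof.
move=> ab.
have sq (m : 'M[R]_n) i : dot y (row i m) ^+ 2 =
    \sum_p \sum_q y 0 p * y 0 q * (m i p * m i q).
  rewrite expr2 /dot mulr_suml; apply: eq_bigr => p _.
  by rewrite mulr_sumr; apply: eq_bigr => q _; rewrite !mxE; ring.
transitivity (\sum_p \sum_q y 0 p * y 0 q * (p == q)%:R); last first.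
  apply: eq_bigr => p _; rewrite (bigD1 p)//= eqxx mulr1 big1 ?addr0// => q qp.
  by rewrite eq_sym (negPf qp) mulr0.
under eq_bigr do rewrite !sq -big_split.
rewrite exchange_big; apply: eq_bigr => p _ /=.
under eq_bigr do rewrite -big_split.
rewrite exchange_big; apply: eq_bigr => q _ /=.
by rewrite -ab mulr_sumr; apply: eq_bigr => i _; ring.
Qed.

Section touching.
Context {R : realType} {n : nat}.
Variables (k : nat) (h eps Rr : R) (J : finType).
Variables (ctr : J -> 'rV[R]_n) (r : J -> R) (G : J -> R -> R).
Hypothesis k0 : (0 < k)%N.
Hypothesis h0 : 0 <= h.
Hypothesis hR : h * Rr <= k%:R.
Hypothesis r0 : forall j, 0 < r j.
Hypothesis Gd : forall j (t : R), r j / 2 < t -> t < Rr + 1 ->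
  is_derive t 1 (G j) (t * kern k h (r j) t).

Definition potential (x : 'rV[R]_n) : R :=
  \sum_j G j (regnorm (r j) (x - ctr j)) - eps.

Variables (phi : 'rV[R]_n -> R) (x0 : 'rV[R]_n).
Hypothesis phiC2 : C2 phi.
Hypothesis phix0 : phi x0 = potential x0.
Hypothesis phi_ge : exists2 d : R, 0 < d &
  forall y, eball x0 d y -> potential y <= phi y.
Hypothesis x0R : forall j, regnorm (r j) (x0 - ctr j) <= Rr.

Let T j := regnorm (r j) (x0 - ctr j).
Let K j := kern k h (r j) (T j).

Let T_gt0 j : 0 < T j.
Proof. by rewrite (lt_le_trans (r0 j))// le_regnorm// ltW. Qed.

Let K_ge0 j : 0 <= K j.
Proof. exact: kern_ge0. Qed.

(** Along the line through [x0] in direction [v], phi minus the potential has a local minimum at 0,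
    so its first derivative vanishes and its second is nonnegative. The sum bounding [quad] from
    below is the Hessian form of the potential. *)
Lemma touching_derivatives (v : 'rV[R]_n) :
  \sum_i v 0 i * grad phi x0 0 i = \sum_j K j * dot (x0 - ctr j) v /\
  \sum_j (K j * dot v v -
     K j * ((k%:R / T j - h) / T j) * dot (x0 - ctr j) v ^+ 2)
    <= quad (hess phi x0) v.
Proof.
have [d d0 hd] := phi_ge.
pose c := 1 + enorm v; have c1 : 1 <= c by rewrite lerDl enorm_ge0.
have c0 : 0 < c by lra.
pose Tj j t := regnorm (r j) (t *: v + (x0 - ctr j)).
pose U1 j t := kern k h (r j) (Tj j t) * (t * dot v v + dot (x0 - ctr j) v).
pose u t := phi (t *: v + x0) - potential (t *: v + x0).
pose u1 t := \sum_i v 0 i * grad phi (t *: v + x0) 0 i - \sum_j U1 j t.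
pose u2 := quad (hess phi x0) v - \sum_j (K j * dot v v -
     K j * ((k%:R / T j - h) / T j) * dot (x0 - ctr j) v ^+ 2).
(* The bound by d keeps the segment where phi dominates the potential; the bound by 1 keeps each
   regularised distance below [Rr + 1], where the profiles are differentiable. *)
pose e := Num.min d 1 / c.
have m0 : 0 < Num.min d 1 by rewrite lt_min d0 ltr01.
have e0 : 0 < e by rewrite divr_gt0.
have te t : `|t| < e -> enorm (t *: v) < Num.min d 1.
  rewrite /e ltr_pdivlMr// enormZ; apply: le_lt_trans.
  by rewrite ler_wpM2l// /c; lra.
have TjE j t : regnorm (r j) (t *: v + x0 - ctr j) = Tj j t by rewrite /Tj addrA.
have Tj0 j : Tj j 0 = T j by rewrite /Tj scale0r add0r.
have Tj_gt j t : r j / 2 < Tj j t.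
  by have := le_regnorm (t *: v + (x0 - ctr j)) (ltW (r0 j)); have := r0 j; rewrite /Tj; lra.
have Tjn0 j t : Tj j t != 0.
  by rewrite gt_eqF// (lt_trans _ (Tj_gt j t))// divr_gt0.
have Tj_lt j t : `|t| < e -> Tj j t < Rr + 1.
  move=> /te; rewrite lt_min => /andP[_ tv1].
  have := regnorm_lip (r j) (x0 - ctr j) (t *: v); have := x0R j.
  by rewrite [x0 - _ + _]addrC -/(Tj j t); lra.
have Tjd j (t : R) : is_derive t 1 (Tj j) ((t * dot v v + dot (x0 - ctr j) v) / Tj j t).
  exact: regnorm_line_is_derive.
have ud (t : R) : `|t| < e -> is_derive t 1 u (u1 t).
  move=> lte; have [pd _] := C2_line x0 v t phiC2.
  have -> : u = (fun t => phi (t *: v + x0)) - (fun t => potential (t *: v + x0)) by [].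
  apply: (is_deriveB pd).
  have -> : (fun t => potential (t *: v + x0)) =
      (fun s => \sum_j G j (Tj j s)) - cst eps.
    by apply/funext => s; rewrite /potential; under eq_bigr do rewrite TjE.
  rewrite -[X in is_derive _ _ _ X]subr0; apply: is_deriveB.
  apply: is_derive1_bigsum => j.
  have := is_derive1_comp (Gd (Tj_gt j t) (Tj_lt j t lte)) (Tjd j t) => H.
  by apply: (is_derive_eq H); rewrite /U1; field.
have u1d : is_derive (0 : R) 1 u1 u2.
  have [_] := C2_line x0 v 0 phiC2; rewrite scale0r add0r => qd.
  have -> : u1 = (fun t => \sum_i v 0 i * grad phi (t *: v + x0) 0 i) -
     (fun t => \sum_j U1 j t) by [].
  apply: (is_deriveB qd).
  apply: is_derive1_bigsum => j.
  have T0' : 0 < Tj j 0 by rewrite Tj0.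
  have dk : is_derive (0 : R) 1 (fun t => kern k h (r j) (Tj j t)) _ :=
    is_derive1_comp (is_derive_kern h (r j) k0 T0') (Tjd j 0).
  have dl : is_derive (0 : R) 1 (fun t => t * dot v v + dot (x0 - ctr j) v) (dot v v).
    by apply: is_derive_eq; rewrite /GRing.scale/=; ring.
  have := is_deriveM dk dl => H; apply: (is_derive_eq H).
  rewrite Tj0 /GRing.scale/= mul0r add0r -/(K j).
  have : T j != 0 by rewrite gt_eqF.
  by move=> ?; field.
have umin t : `|t| < e -> u 0 <= u t.
  move=> /te; rewrite lt_min => /andP[tvd _].
  rewrite /u scale0r add0r phix0 subrr subr_ge0; apply: hd.
  by rewrite /eball/= addrK.
have [u10 u20] := local_min_derive2 e0 ud u1d umin.
split; last by rewrite -subr_ge0.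
move: u10; rewrite /u1 scale0r add0r => /eqP; rewrite subr_eq0 => /eqP ->.
by apply: eq_bigr => j _; rewrite /U1 Tj0 mul0r add0r.
Qed.

Lemma grad_touching : grad phi x0 = \sum_j K j *: (x0 - ctr j).
Proof.
apply/rowP => i; rewrite summxE.
have dotE (y : 'rV[R]_n) : dot y (ebasis R i) = y 0 i.
  rewrite /dot (bigD1 i)//= big1 => [|m mi]; rewrite !mxE ?eqxx ?mulr1 ?addr0//.
  by rewrite (negPf mi) andbF mulr0.
have [+ _] := touching_derivatives (ebasis R i).
rewrite (_ : \sum_i0 _ = dot (grad phi x0) (ebasis R i)) => [|]; last first.
  by apply: eq_bigr => m _; rewrite mulrC.
rewrite dotE => ->; apply: eq_bigr => j _.
by rewrite dotE !mxE.
Qed.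

(** Each eigenvalue is the Hessian form on a unit complex eigenvector. Over k of them the identity
    part contributes k K_j, and by Parseval the rank-one part costs at most c_j |x0 - ctr j|^2, as
    c_j >= 0. The triangle inequality bounds the gradient, and [kern_lower] concludes ball by
    ball. *)
Lemma Fkminus_touching : (k <= n)%N ->
  \sum_j K j * k%:R * r j ^+ 2 / (2 * T j ^+ 2) <= Fkminus k h phi x0.
Proof.
move=> kn; have [a [b [l [charH lE ab1 abd]]]] := symmetric_spectral (hess_sym x0 phiC2).
have [S Sk PE] := Pkminus_subset kn charH; rewrite /Fkminus PE.
have lE' i : l i = quad (hess phi x0) (row i a) + quad (hess phi x0) (row i b).
  rewrite lE -big_split; apply: eq_bigr => p _; rewrite -big_split.
  by apply: eq_bigr => q _; rewrite !mxE mulrDr.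
pose c j := K j * ((k%:R / T j - h) / T j).
have hT j : h * T j <= k%:R by apply: le_trans hR; apply: ler_wpM2l => //; exact: x0R.
have c_ge0 j : 0 <= c j.
  by rewrite mulr_ge0// divr_ge0 ?(ltW (T_gt0 j))// subr_ge0 ler_pdivlMr.
have row1 i : dot (row i a) (row i a) + dot (row i b) (row i b) = 1.
  by rewrite -(ab1 i) -big_split; apply: eq_bigr => p _; rewrite !mxE !expr2.
pose s i j := dot (x0 - ctr j) (row i a) ^+ 2 + dot (x0 - ctr j) (row i b) ^+ 2.
have s_ge0 i j : 0 <= s i j by rewrite addr_ge0 ?sqr_ge0.
have l_ge i : \sum_j (K j - c j * s i j) <= l i.
  rewrite lE'; have [_ A] := touching_derivatives (row i a).
  have [_ B] := touching_derivatives (row i b).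
  apply: le_trans (lerD A B); rewrite -big_split/=; apply: ler_sum => j _.
  rewrite [leRHS](_ : _ = K j * (dot (row i a) (row i a) + dot (row i b) (row i b))
    - c j * s i j); first by rewrite row1 mulr1.
  by rewrite /c /s; ring.
have grad_le : enorm (grad phi x0) <= \sum_j K j * enorm (x0 - ctr j).
  rewrite grad_touching; apply: (le_trans (ler_enorm_sum _)).
  by apply: ler_sum => j _; rewrite enormZ ger0_norm.
have P_ge : \sum_j (K j * k%:R - c j * enorm (x0 - ctr j) ^+ 2) <= \sum_(i in S) l i.
  apply: (@le_trans _ _ (\sum_(i in S) \sum_j (K j - c j * s i j))); last first.
    by apply: ler_sum => i _; exact: l_ge.
  rewrite exchange_big; apply: ler_sum => j _ /=.
  rewrite big_split/= sumr_const Sk mulr_natr lerD2l sumrN lerN2 -mulr_sumr.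
  apply: ler_wpM2l => //; rewrite sqr_enorm -(sum_sqr_dot_rows _ abd).
  by rewrite [leRHS](bigID (mem S))/= lerDl; apply: sumr_ge0 => i _; exact: s_ge0.
have := ler_wpM2l h0 grad_le; have := P_ge.
rewrite mulr_sumr => A B.
apply: (@le_trans _ _ (\sum_j (K j * k%:R - c j * enorm (x0 - ctr j) ^+ 2)
   - \sum_j h * (K j * enorm (x0 - ctr j)))); last by lra.
rewrite -sumrB; apply: ler_sum => j _.
have := kern_lower (r0 j) (enorm_ge0 (x0 - ctr j)) (T_gt0 j) h0
  (sqr_regnorm (r j) (x0 - ctr j)) (hT j).
move=> /le_trans; apply; rewrite -/(K j) /c; lra.
Qed.

End touching.

                               

(** * Admissibility of the potential *)

Section upper_semicontinuity.
Context {R : realType} {n : nat}.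
Implicit Types (S : set 'rV[R]_n) (f g : 'rV[R]_n -> R).

Lemma usc_on_cst S (c : R) : usc_on S (fun=> c).
Proof. by move=> x _ e e0; exists 1 => // y _ _; rewrite ltrDl. Qed.

Lemma usc_onD S f g : usc_on S f -> usc_on S g -> usc_on S (fun x => f x + g x).
Proof.
move=> uf ug x Sx e e0; have e20 : 0 < e / 2 by rewrite divr_gt0.
have [d1 d10 h1] := uf x Sx _ e20; have [d2 d20 h2] := ug x Sx _ e20.
exists (Num.min d1 d2) => [|y Sy]; first by rewrite lt_min d10.
rewrite lt_min => /andP[/h1 - /(_ Sy) + /h2 - /(_ Sy)]; lra.
Qed.

Lemma usc_on_sum S (I : finType) (F : I -> 'rV[R]_n -> R) :
  (forall i, usc_on S (F i)) -> usc_on S (fun x => \sum_i F i x).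
Proof.
move=> uF; elim: (index_enum I) => [|i s IH].
  by under eq_fun do rewrite big_nil; exact: usc_on_cst.
by under eq_fun do rewrite big_cons; exact: usc_onD.
Qed.

Lemma usc_on_regnorm S (G : R -> R) (r : R) (p : 'rV[R]_n) :
  (forall x, S x -> {for regnorm r (x - p), continuous G}) ->
  usc_on S (fun x => G (regnorm r (x - p))).
Proof.
move=> Gc x Sx e e0; move: (Gc x Sx) => /cvgrPdist_lt/(_ _ e0)/nbhs_normP[d /= d0 hd].
exists d => // y Sy yx.
have xy := regnorm_lip r (x - p) (y - x).
have yx' := regnorm_lip r (y - p) (x - y).
have xyE : x - p + (y - x) = y - p by rewrite addrC addrA subrK.
have yxE : y - p + (x - y) = x - p by rewrite addrC addrA subrK.
have xyd : `|regnorm r (x - p) - regnorm r (y - p)| < d.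
  move: xy yx'; rewrite xyE yxE (enormBC x y) ltr_norml => xy yx'.
  by apply/andP; split; lra.
by have := hd _ xyd; rewrite /= ltr_norml => /andP[]; lra.
Qed.

End upper_semicontinuity.

Section potential_bound.
Context {R : realType} {n : nat}.
Variables (k : nat) (h eps Rr : R) (J : finType).
Variables (ctr : J -> 'rV[R]_n) (r : J -> R) (G : J -> R -> R).
Hypothesis k0 : (0 < k)%N.
Hypothesis kn : (k <= n)%N.
Hypothesis h0 : 0 <= h.
Hypothesis hR : h * Rr <= k%:R.
Hypothesis eps0 : 0 < eps.
Hypothesis r0 : forall j, 0 < r j.
Hypothesis Gd : forall j (t : R), r j / 2 < t -> t < Rr + 1 ->
  is_derive t 1 (G j) (t * kern k h (r j) t).
Hypothesis G_le0 : forall j (t : R), r j <= t -> t <= Rr -> G j t <= 0.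

Let T j x := regnorm (r j) (x - ctr j).

(** The potential itself is the function w for [Omega], which reduces the viscosity condition to a
    pointwise inequality. *)
Lemma mubar_ge_of_potential (Omega E : set 'rV[R]_n) (c : R) :
  open Omega -> E `<=` Omega ->
  (forall x, closure Omega x -> forall j, T j x <= Rr) ->
  (forall x, Omega x ->
     0 <= \sum_j kern k h (r j) (T j x) * k%:R * r j ^+ 2 / (2 * T j x ^+ 2)
          + c * potential eps ctr r G x) ->
  (c%:E <= mubar k h E)%E.
Proof.
move=> Oo EO OR OF.
apply: (@le_trans _ _ (mubar_open k h Omega)); last first.
  by apply: ereal_sup_ubound; exists Omega.
apply: ereal_sup_ubound; exists c => //=; exists (potential eps ctr r G).
split; [|split].
- apply: usc_onD; last exact: usc_on_cst.
  apply: usc_on_sum => j; apply: usc_on_regnorm => x Ox.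
  have xR := OR x Ox j; have rx := le_regnorm (x - ctr j) (ltW (r0 j)).
  have rj := r0 j; apply: (is_derive1_continuous (@Gd j _ _ _)); rewrite /T in xR; lra.
- move=> x Ox; rewrite /potential subr_lt0; apply: le_lt_trans eps0.
  apply: sumr_le0 => j _; apply: G_le0; first by rewrite le_regnorm// ltW.
  exact: OR.
- move=> x Ox phi phiC2 phix phige.
  have xR j : regnorm (r j) (x - ctr j) <= Rr by apply: OR; exact: subset_closure.
  apply: (le_trans (OF x Ox)); rewrite lerD2r.
  exact: (Fkminus_touching k0 h0 hR r0 Gd phiC2 phix phige xR kn).
Qed.

End potential_bound.

(** * Lower bounds from covers by balls *)

Lemma PsiK_ge0 (R : realType) (k : nat) (Rr t : R) :
  0 <= Rr -> 0 <= t -> 0 <= PsiK k Rr t.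
Proof.
move=> R0 t0; rewrite /PsiK; case: ifP => _; first exact: mulr_ge0.
by case: ifP => _; rewrite ?mulr_ge0 ?sqr_ge0.
Qed.

Section mubar_lower_bounds.
Context {R : realType} {n : nat}.
Variables (k : nat) (h Rr : R).
Hypothesis k0 : (0 < k)%N.
Hypothesis kn : (k <= n)%N.
Hypothesis h0 : 0 <= h.
Hypothesis R0 : 0 < Rr.
Hypothesis hR : h * Rr <= k%:R.
Implicit Type E : set 'rV[R]_n.

(** With an empty family of balls the potential is the constant -1 on the whole space, admissible
    for c = 0. This covers the case of infinite Hausdorff measure. *)
Lemma mubar_ge0 E : (0 <= mubar k h E)%E.
Proof.
apply: (@mubar_ge_of_potential R n k h 1 Rr void (fun=> 0) (fun=> 1) (fun=> id)
  k0 kn h0 hR ltr01 _ _ _ setT E 0) => //; first exact: openT.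
by move=> x _; rewrite mul0r addr0 sumr_ge0// => -[].
Qed.

Lemma mubar_ge_finite_cover E (J : finType) (ctr : J -> 'rV[R]_n) (r : J -> R)
    (c S : R) :
  (forall j, 0 < r j) -> (forall j, r j < Rr) ->
  E `<=` \bigcup_j eball (ctr j) (r j) ->
  (forall x, closure (\bigcup_j eball (ctr j) (r j)) x ->
    forall j, regnorm (r j) (x - ctr j) <= Rr) ->
  \sum_j PsiK k Rr (r j) < S -> 0 <= c ->
  c * (expR (h * Rr) * S) <= k%:R / 4 / 2 ^+ k ->
  (c%:E <= mubar k h E)%E.
Proof.
move=> r0 rR Ecov OR SPsi c0 cS.
have /choice[G GP] j := profile_exists k0 h0 (r0 j) (rR j).
pose M := expR (h * Rr); have M0 : 0 < M by exact: expR_gt0.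
(* All the slack in the strict bound by S goes into the shift, so the potential is negative and
   still at least [- (M * S)]. *)
pose eps := M * (S - \sum_j PsiK k Rr (r j)).
have eps0 : 0 < eps by rewrite mulr_gt0// subr_gt0.
apply: (@mubar_ge_of_potential R n k h eps Rr J ctr r G k0 kn h0 hR eps0 r0 _ _
  (\bigcup_j eball (ctr j) (r j))) => //.
- by move=> j; have [] := GP j.
- by move=> j t rt tR; have [_ /(_ t rt tR)[]] := GP j.
- by apply: bigcup_open => j _; exact: open_eball.
move=> x Ox; have xR := OR x (subset_closure Ox).
have T0 j : 0 < regnorm (r j) (x - ctr j).
  by rewrite (lt_le_trans (r0 j))// le_regnorm// ltW.
have w_ge : - (M * S) <= potential eps ctr r G x.
  have : - (M * \sum_j PsiK k Rr (r j)) <= \sum_j G j (regnorm (r j) (x - ctr j)).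
    rewrite mulr_sumr -sumrN; apply: ler_sum => j _.
    by have [_ /(_ _ (le_regnorm _ (ltW (r0 j))) (xR j))[]] := GP j.
  by rewrite /potential /eps mulrBr; lra.
have cw := ler_wpM2l c0 w_ge.
have [j _ xj] := Ox.
(* The ball containing x alone pays for the term in c; the other contributions are nonnegative. *)
rewrite (bigD1 j)//=.
have near := kern_lower_near k (r0 j) (enorm_ge0 (x - ctr j)) (T0 j) h0
  (sqr_regnorm (r j) (x - ctr j)) xj.
set rest := \sum_(_ | _) _.
have rest0 : 0 <= rest.
  apply: sumr_ge0 => i _; apply: mulr_ge0; last by rewrite invr_ge0 mulr_ge0// sqr_ge0.
  by apply: mulr_ge0; [apply: mulr_ge0; rewrite ?kern_ge0 | exact: sqr_ge0].
rewrite -/M in cS; lra.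
Qed.

End mubar_lower_bounds.

Lemma sum_fset_le_nneseries (R : realType) (u : nat -> R) (D : {fset nat}) :
  (forall j, 0 <= u j) ->
  ((\sum_(j : D) u (val j))%:E <= \sum_(0 <= j <oo) (u j)%:E)%E.
Proof.
move=> u0; pose N := (\max_(j <- D) j).+1.
apply: le_trans (nneseries_lim_ge N _); last by move=> j _ _; rewrite lee_fin.
rewrite sumEFin lee_fin -(big_seq_fsetE _ _ xpredT u)/=.
have -> : \sum_(j <- D) u j = \sum_(0 <= j < N | j \in D) u j.
  rewrite -[RHS]big_filter; apply/perm_big/uniq_perm; rewrite ?filter_uniq ?iota_uniq//.
  move=> j; rewrite mem_filter mem_index_iota /= /N.
  case jD : (j \in D) => //=; symmetry; rewrite ltnS.
  apply: leq_bigmax_seq jD isT.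
by rewrite big_mkcond/=; apply: ler_sum => j _; case: ifP.
Qed.

Lemma ediam_lt_bound (R : realType) (n : nat) (E : set 'rV[R]_n) (Rr : R) :
  0 < Rr -> (ediam E < Rr%:E)%E ->
  exists2 d, d < Rr & forall x y, E x -> E y -> enorm (x - y) <= d.
Proof.
move=> R0 dR; have le_diam x y : E x -> E y -> ((enorm (x - y))%:E <= ediam E)%E.
  by move=> Ex Ey; apply: ereal_sup_ubound; exists x => //; exists y.
case: (ediam E) dR le_diam => [d| |] //.
  by rewrite lte_fin => dR hd; exists d => // x y Ex Ey; rewrite -lee_fin hd.
(* The diameter is [-oo] only for an empty set, where the bound holds vacuously. *)
by move=> _ hd; exists 0 => // x y Ex Ey; have := hd x y Ex Ey.
Qed.

Lemma mubar_ge_cover (R : realType) (n k : nat) (h Rr d : R) (E : set 'rV[R]_n)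
    (r : nat -> R) (x : nat -> 'rV[R]_n) (c S : R) :
  (0 < k)%N -> (k <= n)%N -> 0 <= h -> 0 < Rr -> h * Rr <= k%:R ->
  compact E -> d < Rr -> (forall y z, E y -> E z -> enorm (y - z) <= d) ->
  (forall j, 0 <= r j <= (Rr - d) / 5) ->
  E `<=` \bigcup_j eball (x j) (r j) ->
  (\sum_(0 <= j <oo) (PsiK k Rr (r j))%:E < S%:E)%E -> 0 <= c ->
  c * (expR (h * Rr) * S) <= k%:R / 4 / 2 ^+ k ->
  (c%:E <= mubar k h E)%E.
Proof.
move=> k0 kn h0 R0 hR cE dR dE r_bd Ecov sumS c0 cS.
(* Only balls meeting [E] are kept: their radii are positive and their centres lie close to [E]. *)
pose D := [set j | exists2 y, E y & eball (x j) (r j) y].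
have Dr j : D j -> 0 < r j.
  by move=> [y _]; rewrite /eball/=; apply: le_lt_trans; exact: enorm_ge0.
move: cE; rewrite compact_cover => /(_ nat D (fun j => eball (x j) (r j)))[].
- by move=> j _; exact: open_eball.
- by move=> y Ey; have [j _ yj] := Ecov y Ey; exists j => //; exists y.
move=> D' D'D D'cov.
have DD (j : D') : D (val j) by have := D'D _ (valP j); rewrite inE.
apply: (@mubar_ge_finite_cover R n k h Rr k0 kn h0 hR E D'
  (fun j => x (val j)) (fun j => r (val j)) c S) => //.
- by move=> j; apply: Dr.
- move=> j; have [y Ey yj] := DD j; have := dE _ _ Ey Ey.
  by rewrite subrr enorm0 => d0; have /andP[_] := r_bd (val j); lra.
- move=> y /D'cov[j jD' yj].
  by exists [` jD']%fset.
- move=> y yO j; have [e Ee ej] := DD j.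
  have rj0 := Dr _ (DD j).
  have [|z [[i _ zi] yz]] := yO (eball y (r (val j))); first exact: nbhs_eball.
  have [e' Ee' ei] := DD i.
  have /andP[_ ri] := r_bd (val i); have /andP[_ rj] := r_bd (val j).
  (* The path y, z, [x i], e', e, [x j] costs four radii plus d, and [regnorm] adds one more radius:
     hence the divisor 5 in the bound on the radii. *)
  apply: (le_trans (regnorm_le _ (ltW rj0))).
  move: zi yz ej ei; rewrite /eball/= => zi yz ej ei.
  have := ler_enormB y z (x (val j)); rewrite (enormBC y z).
  have := ler_enormB z (x (val i)) (x (val j)).
  have := ler_enormB (x (val i)) e' (x (val j)); rewrite (enormBC (x (val i)) e').
  have := ler_enormB e' e (x (val j)); have := dE _ _ Ee' Ee.
  lra.
rewrite -lte_fin; apply: le_lt_trans sumS.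
apply: (@sum_fset_le_nneseries R (fun j => PsiK k Rr (r j)) D') => j.
by apply: PsiK_ge0; [exact: ltW | have /andP[] := r_bd j].
Qed.

(** * From covers to the Hausdorff measure *)

Lemma hausdorffPsi_ge0 (R : realType) (n : nat) (Psi : R -> R) (E : set 'rV[R]_n) :
  (forall t, 0 <= t -> 0 <= Psi t) -> (0 <= hausdorffPsi Psi E)%E.
Proof.
move=> Psi0; apply: (@le_trans _ _ (hausdorff_delta Psi E 1)); last first.
  by apply: ereal_sup_ubound; exists 1 => //=.
apply: le_ereal_inf_tmp => _ /= [r [x [r01 _]] <-].
by apply: nneseries_ge0 => j _ _; rewrite lee_fin Psi0//; have /andP[] := r01 j.
Qed.

(** The measure is a supremum over scales, so at the single scale (Rr - d)/5 there is already a
    cover with sum below S; [mubar_ge_cover] then applies with c = C/S. *)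
Lemma mubar_ge_hausdorff (R : realType) (n k : nat) (h Rr : R) (E : set 'rV[R]_n)
    (C S : R) :
  (0 < k)%N -> (k <= n)%N -> 0 <= h -> 0 < Rr -> h * Rr <= k%:R ->
  compact E -> (ediam E < Rr%:E)%E -> 0 <= C ->
  C * expR (h * Rr) <= k%:R / 4 / 2 ^+ k ->
  0 < S -> (hausdorffPsi (PsiK k Rr) E < S%:E)%E -> ((C / S)%:E <= mubar k h E)%E.
Proof.
move=> k0 kn h0 R0 hR cE dER C0 CM S0 HS.
have [d dR dE] := ediam_lt_bound R0 dER.
pose delta := (Rr - d) / 5.
have delta0 : 0 < delta by rewrite divr_gt0// subr_gt0.
have : (hausdorff_delta (PsiK k Rr) E delta < S%:E)%E.
  by apply: le_lt_trans HS; apply: ereal_sup_ubound; exists delta.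
move=> /ereal_inf_lt[_ /= [r [x [r_bd Ecov]] <-] sumS].
apply: (mubar_ge_cover k0 kn h0 R0 hR cE dR dE r_bd Ecov sumS) => //.
  by rewrite divr_ge0// ltW.
by rewrite mulrCA divfK ?gt_eqF// mulrC.
Qed.

Unset Implicit Arguments.
Set Strict Implicit.
Set Printing Implicit Defensive.

Theorem mainTheorem1 (R : realType) (n k : nat) (hR : R) :
  (2 <= n)%N -> (1 <= k)%N -> (k <= n.-1)%N ->
  0 <= hR -> hR < k%:R ->
  exists2 C : R, 0 < C &
    forall (Rr h : R) (E : set 'rV[R]_n),
      0 < Rr -> 0 <= h -> h * Rr = hR ->
      compact E -> (ediam E < Rr%:E)%E ->
      (ediv_const C (hausdorffPsi (PsiK k Rr) E) <= mubar k h E)%E.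
Proof.
move=> n2 k0 kn1 hR0 hRk.
have kn : (k <= n)%N by apply: leq_trans kn1 (leq_pred n).
(* The gain of [kern_lower_near] divided by the factor e^{hR} in the lower bound for the
   profiles. *)
pose C : R := k%:R / 4 / 2 ^+ k / expR hR.
have C0 : 0 < C by rewrite !divr_gt0 ?expR_gt0 ?exprn_gt0 ?ltr0n.
exists C => // Rr h E R0 h0 hRr cE dE.
have hRk' : h * Rr <= k%:R by rewrite hRr ltW.
have CM : C * expR (h * Rr) <= k%:R / 4 / 2 ^+ k.
  by rewrite hRr /C divfK// gt_eqF// expR_gt0.
have key S : 0 < S -> (hausdorffPsi (PsiK k Rr) E < S%:E)%E ->
    ((C / S)%:E <= mubar k h E)%E.
  exact: mubar_ge_hausdorff k0 kn h0 R0 hRk' cE dE (ltW C0) CM.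
have : (0 <= hausdorffPsi (PsiK k Rr) E)%E.
  by apply: hausdorffPsi_ge0 => t; apply: PsiK_ge0; exact: ltW.
have mu0 := mubar_ge0 k0 kn h0 hRk' E.
case: (hausdorffPsi _ _) key => [H| |] key //= H0.
case: ifPn => [/eqP HE|HN0].
  suff -> : mubar k h E = +oo%E by [].
  (* For zero measure every positive S is allowed, and S = C/A reaches any prescribed A. *)
  apply/eqyP => A A0; have -> : A = C / (C / A) by field; rewrite !gt_eqF.
  by apply: key; rewrite ?HE ?lte_fin divr_gt0.
have {H0}HN : 0 < H by rewrite lt_def HN0 -lee_fin.
case: (mubar k h E) key mu0 => [m| |] key mu0 /=; [|exact: leey|by []].
have m0 : 0 <= m by rewrite -lee_fin.
rewrite lee_fin ler_pdivrMr//; apply/ler_addgt0Pr => e e0.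
have m10 : 0 < m + 1 by rewrite ltr_wpDl.
(* S is taken just above H; the excess e/(m+1), once multiplied by m, stays below e, also when m =
   0. *)
have e'0 : 0 < e / (m + 1) by rewrite divr_gt0.
have := key (H + e / (m + 1)); rewrite lte_fin lee_fin ltrDl e'0 addr_gt0//.
move=> /(_ isT isT); rewrite ler_pdivrMr ?addr_gt0// mulrDr => /le_trans; apply.
rewrite lerD2l mulrCA -[leRHS]mulr1 ler_wpM2l ?(ltW e0)// ler_pdivrMr// mul1r.
by rewrite lerDl.
Qed.
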